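(* Let $A$ be a commutative $C^*$-algebra with spectrum $\Delta(A)$, let $\sigma : A \to A$ be an automorphism, and let $\mathscr{C}$ be the closed commutator ideal of $\ell_1^{\widehat{\sigma}}(\mathbb{Z}, C_0(\Delta(A)))$. Then $\mathscr{C} = \mathrm{Ker}(\mathrm{Per}^1(\Delta(A)))$.
   Context: $A$ is not assumed unital; it is identified with $C_0(\Delta(A))$ by the Gelfand transform. The automorphism $\sigma$ induces a homeomorphism $\widetilde{\sigma}:\Delta(A)\to\Delta(A)$, $\widetilde{\sigma}(\mu)=\mu\circ\sigma^{-1}$, and an automorphism $\widehat{\sigma}$ of $C_0(\Delta(A))$, $\widehat{\sigma}(f)=f\circ\widetilde{\sigma}^{-1}$. The Banach algebra $\ell_1^{\widehat{\sigma}}(\mathbb{Z}, C_0(\Delta(A)))$ is the set of formal sums $\sum_{n\in\mathbb{Z}} f_n\delta^n$ with $f_n\in C_0(\Delta(A))$ and $\sum_n\|f_n\|<\infty$, with norm $\sum_n\|f_n\|$, coefficientwise addition and scalar multiplication, and (twisted convolution) multiplication determined by $(f_n\delta^n)*(g_m\delta^m)=f_n\cdot\widehat{\sigma}^n(g_m)\,\delta^{n+m}$. The closed commutator ideal is the closed two-sided ideal generated by all commutators $a*b-b*a$. $\mathrm{Per}^1(\Delta(A))=\{x\in\Delta(A) : \widetilde{\sigma}(x)=x\}$. For $S\subseteq\Delta(A)$, $\mathrm{Ker}(S)=\{\sum_{n\in\mathbb{Z}} f_n\delta^n\in\ell_1^{\widehat{\sigma}}(\mathbb{Z}, C_0(\Delta(A)))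 : f_n(x)=0 \text{ for all } x\in S,\ n\in\mathbb{Z}\}$. *)

(* Defs.v *)
From HB Require Import structures.
From mathcomp Require Import all_boot all_order all_algebra.
From mathcomp Require Import complex.
From mathcomp Require Import all_classical all_reals all_analysis.

Set Implicit Arguments.
Unset Strict Implicit.
Unset Printing Implicit Defensive.

Import Order.TTheory GRing.Theory Num.Theory.
Import numFieldNormedType.Exports.
Import ComplexField.Normc.

Local Open Scope classical_set_scope.
Local Open Scope complex_scope.
Local Open Scope ring_scope.

(* The library has the norm topology of C only on the alias [R[i]^o]. *)
HB.instance Definition _ (R : realType) := NormedModule.copy R[i] R[i]^o.

Section Normc.
Variable R : realType.
Implicit Types x y : R[i].

Lemma normcE x : `|x| = (normc x)%:C. Proof. by []. Qed.

Lemma normc_ge0 x : 0 <= normc x.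
Proof. by case: x => a b; exact: sqrtr_ge0. Qed.

Lemma ler_normcD x y : normc (x + y) <= normc x + normc y.
Proof. by rewrite -lecR rmorphD -!normcE ler_normD. Qed.

Lemma ler_normc_dist x y : `|normc x - normc y| <= normc (x - y).
Proof.
have sub (u v : R[i]) : normc u - normc v <= normc (u - v).
  by rewrite lerBlDr (le_trans _ (ler_normcD _ _))// subrK.
by rewrite ler_norml sub lerNl opprB (le_trans (sub _ _))// -opprB normcN.
Qed.

End Normc.

(* Complex commutative C*-algebras; no unit is assumed. *)
HB.mixin Record CompleteNormedModule_isComCstarAlg (R : realType) A
    & CompleteNormedModule R[i] A := {
  cmul : A -> A -> A;
  cstar : A -> A;
  cmulA : associative cmul;
  cmulC : commutative cmul;
  cmulDl : left_distributive cmul +%R;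
  cmulZl : forall (k : R[i]) (a b : A), cmul (k *: a) b = k *: cmul a b;
  norm_cmul_le : forall a b : A, `|cmul a b| <= `|a| * `|b|;
  cstarD : forall a b : A, cstar (a + b) = cstar a + cstar b;
  cstarZ : forall (k : R[i]) (a : A), cstar (k *: a) = k^* *: cstar a;
  cstarM : forall a b : A, cstar (cmul a b) = cmul (cstar b) (cstar a);
  cstarK : involutive cstar;
  norm_cstarM : forall a : A, `|cmul (cstar a) a| = `|a| ^+ 2;
}.

#[short(type="comCstarAlgType")]
HB.structure Definition ComCstarAlg (R : realType) :=
  { A of CompleteNormedModule R[i] A & CompleteNormedModule_isComCstarAlg R A }.

(* Algebra automorphisms. An algebra automorphism of a commutative C*-algebra  *)
(* automatically preserves the involution, so these are the *-automorphisms.  *)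
Record automorphism (R : realType) (A : comCstarAlgType R) := Automorphism {
  aut_fun :> A -> A;
  aut_inv : A -> A;
  aut_funK : cancel aut_fun aut_inv;
  aut_invK : cancel aut_inv aut_fun;
  aut_linear : linear aut_fun;
  aut_mul : forall a b : A, aut_fun (cmul a b) = cmul (aut_fun a) (aut_fun b);
}.

Section Spectrum.
Variables (R : realType) (A : comCstarAlgType R).

Definition character (mu : A -> R[i]) : Prop :=
  [/\ scalar mu,
      forall a b, mu (cmul a b) = mu a * mu b &
      exists a, mu a != 0].

(* The Gelfand topology, i.e. the subtype topology induced by pointwise        *)
(* convergence on A.                                                          *)
Definition spectrum := set_type [set mu : {ptws A -> R[i]} | character mu].

HB.instance Definition _ := Topological.on spectrum.

Definition spectrum_eval (mu : spectrum) (a : A) : R[i] := val mu a.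

End Spectrum.

Record homeomorphism (X : topologicalType) := Homeomorphism {
  homeo_fun :> X -> X;
  homeo_inv : X -> X;
  homeo_funK : cancel homeo_fun homeo_inv;
  homeo_invK : cancel homeo_inv homeo_fun;
  homeo_continuous : continuous homeo_fun;
  homeo_inv_continuous : continuous homeo_inv;
}.

Definition homeo_sym (X : topologicalType) (s : homeomorphism X) :=
  Homeomorphism (homeo_invK s) (homeo_funK s)
    (@homeo_inv_continuous _ s) (@homeo_continuous _ s).

Section InducedHomeomorphism.
Variables (R : realType) (A : comCstarAlgType R).

Lemma aut_inv_linear (sigma : automorphism A) : linear (aut_inv sigma).
Proof.
move=> k a b; apply: (can_inj (aut_funK sigma)).
by rewrite aut_linear !aut_invK.
Qed.

Lemma aut_inv_mul (sigma : automorphism A) a b :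
  aut_inv sigma (cmul a b) = cmul (aut_inv sigma a) (aut_inv sigma b).
Proof.
apply: (can_inj (aut_funK sigma)).
by rewrite aut_mul !aut_invK.
Qed.

Definition aut_sym (sigma : automorphism A) : automorphism A :=
  Automorphism (aut_invK sigma) (aut_funK sigma)
    (aut_inv_linear sigma) (aut_inv_mul sigma).

Lemma character_comp_aut (sigma : automorphism A) (mu : A -> R[i]) :
  character mu -> character (mu \o sigma).
Proof.
move=> [lin mult [a mua]]; split=> [k b c | b c |] /=.
- by rewrite aut_linear lin.
- by rewrite aut_mul mult.
- by exists (aut_inv sigma a); rewrite /= aut_invK.
Qed.

Definition spectrum_comp (sigma : automorphism A) (mu : spectrum A) :
    spectrum A :=
  exist _ (spectrum_eval mu \o sigma : {ptws A -> R[i]})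
    (mem_set (character_comp_aut sigma (set_mem (valP mu)))).

Lemma spectrum_comp_continuous (sigma : automorphism A) :
  continuous (spectrum_comp sigma).
Proof.
apply: (@continuous_comp_initial _ _ {ptws A -> R[i]} set_val) => mu.
have FF := @fmap_filter _ _ (set_val \o spectrum_comp sigma) _ (@nbhs_filter _ mu).
apply/pointwise_cvgP => a /=.
have GF := @fmap_filter _ _ (set_val : spectrum A -> {ptws A -> R[i]}) _ (@nbhs_filter _ mu).
have : {ptws, (set_val : spectrum A -> {ptws A -> R[i]}) @ nbhs mu --> set_val mu}.
  exact: initial_continuous.
move=> /pointwise_cvgP/(_ (sigma a)).
exact.
Qed.

Lemma spectrum_compK (sigma : automorphism A) :
  cancel (spectrum_comp sigma) (spectrum_comp (aut_sym sigma)).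
Proof.
move=> mu; apply: val_inj; apply/funext => a /=.
by rewrite /spectrum_eval /= aut_invK.
Qed.

Lemma spectrum_comp_symK (sigma : automorphism A) :
  cancel (spectrum_comp (aut_sym sigma)) (spectrum_comp sigma).
Proof.
move=> mu; apply: val_inj; apply/funext => a /=.
by rewrite /spectrum_eval /= aut_funK.
Qed.

Definition sigma_tilde (sigma : automorphism A) : homeomorphism (spectrum A) :=
  Homeomorphism (spectrum_comp_symK sigma) (spectrum_compK sigma)
    (@spectrum_comp_continuous (aut_sym sigma))
    (@spectrum_comp_continuous sigma).

Lemma sigma_tildeE (sigma : automorphism A) (mu : spectrum A) (a : A) :
  spectrum_eval (sigma_tilde sigma mu) a = spectrum_eval mu (aut_inv sigma a).
Proof. by []. Qed.

End InducedHomeomorphism.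

Definition vanishes_at_infinity (R : realType) (X : topologicalType)
    (f : X -> R[i]) : Prop :=
  forall e : R, 0 < e ->
    exists2 K, compact K & forall x, ~ K x -> normc (f x) < e.

Record C0 (R : realType) (X : topologicalType) := MkC0 {
  C0_fun :> X -> R[i];
  C0_continuous : continuous C0_fun;
  C0_vanishing : vanishes_at_infinity C0_fun;
}.

Section C0Theory.
Variables (R : realType) (X : topologicalType).
Implicit Types f g h : C0 R X.

Lemma C0P f g : f =1 g -> f = g.
Proof.
case: f g => [f cf vf] [g cg vg] /= /funext fg; subst g.
by rewrite (Prop_irrelevance cf cg) (Prop_irrelevance vf vg).
Qed.

HB.instance Definition _ := gen_eqMixin (C0 R X).
HB.instance Definition _ := gen_choiceMixin (C0 R X).

Lemma vanishes_dominated (u v : X -> R[i]) (M : R) : 0 <= M ->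
  (forall x, normc (u x) <= M * normc (v x)) ->
  vanishes_at_infinity v -> vanishes_at_infinity u.
Proof.
move=> M0 uv vv e e0; have M1 : 0 < M + 1 by rewrite ltr_wpDl.
have [K cK vK] := vv (e / (M + 1)) (divr_gt0 e0 M1).
exists K => // x /vK; rewrite ltr_pdivlMr// => /le_lt_trans; apply.
rewrite (le_trans (uv x))// mulrC ler_wpM2l ?normc_ge0//.
by rewrite lerDl.
Qed.

Lemma C0_zero_vanishing : vanishes_at_infinity (fun _ : X => 0 : R[i]).
Proof. by move=> e e0; exists set0; [exact: compact0|move=> x _; rewrite normc0]. Qed.

Definition C0_zero : C0 R X := MkC0 (@cst_continuous _ _ 0) C0_zero_vanishing.

Lemma C0_add_continuous f g : continuous (fun x => f x + g x).
Proof. by move=> x; apply: cvgD; exact: C0_continuous. Qed.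

Lemma C0_add_vanishing f g : vanishes_at_infinity (fun x => f x + g x).
Proof.
move=> e e0; have e2 : 0 < e / 2 by rewrite divr_gt0.
have [K cK fK] := C0_vanishing f e2; have [L cL gL] := C0_vanishing g e2.
exists (K `|` L) => [|x /not_orP[nK nL]]; first exact: compactU.
by rewrite (le_lt_trans (ler_normcD _ _))// (splitr e) ltrD ?fK ?gL.
Qed.

Definition C0_add f g : C0 R X :=
  MkC0 (@C0_add_continuous f g) (@C0_add_vanishing f g).

Lemma C0_scale_continuous (k : R[i]) f : continuous (fun x => k * f x).
Proof. by move=> x; apply: cvgM; [exact: cvg_cst|exact: C0_continuous]. Qed.

Lemma C0_scale_vanishing (k : R[i]) f : vanishes_at_infinity (fun x => k * f x).
Proof.
apply: (vanishes_dominated (normc_ge0 k) _ (@C0_vanishing _ _ f)) => x.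
by rewrite normcM.
Qed.

Definition C0_scale (k : R[i]) f : C0 R X :=
  MkC0 (@C0_scale_continuous k f) (@C0_scale_vanishing k f).

Definition C0_opp f : C0 R X := C0_scale (-1) f.

Fact C0_addA : associative C0_add.
Proof. by move=> f g h; apply: C0P => x /=; rewrite addrA. Qed.
Fact C0_addC : commutative C0_add.
Proof. by move=> f g; apply: C0P => x /=; rewrite addrC. Qed.
Fact C0_add0 : left_id C0_zero C0_add.
Proof. by move=> f; apply: C0P => x /=; rewrite add0r. Qed.
Fact C0_addN : left_inverse C0_zero C0_opp C0_add.
Proof. by move=> f; apply: C0P => x /=; rewrite mulN1r addNr. Qed.

HB.instance Definition _ :=
  GRing.isZmodule.Build (C0 R X) C0_addA C0_addC C0_add0 C0_addN.

Fact C0_scaleA (k l : R[i]) f : C0_scale k (C0_scale l f) = C0_scale (k * l) f.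
Proof. by apply: C0P => x /=; rewrite mulrA. Qed.
Fact C0_scale1 : left_id 1 C0_scale.
Proof. by move=> f; apply: C0P => x /=; rewrite mul1r. Qed.
Fact C0_scaleDr : right_distributive C0_scale +%R.
Proof. by move=> k f g; apply: C0P => x /=; rewrite mulrDr. Qed.
Fact C0_scaleDl f (k l : R[i]) : C0_scale (k + l) f = C0_scale k f + C0_scale l f.
Proof. by apply: C0P => x /=; rewrite mulrDl. Qed.

HB.instance Definition _ := GRing.Zmodule_isLmodule.Build R[i] (C0 R X)
  C0_scaleA C0_scale1 C0_scaleDr C0_scaleDl.

Definition C0_norm f : R := sup [set normc (f x) | x in [set: X]].

Lemma C0_normc_continuous f : continuous (fun x => normc (f x) : R).
Proof.
move=> x; apply/cvgrPdist_lt => e e0.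
have e0C : 0 < e%:C :> R[i] by rewrite ltcR.
have /cvgrPdist_lt/(_ _ e0C) := @C0_continuous _ _ f x.
apply: filterS => y; rewrite normcE ltcR => /le_lt_trans; apply.
exact: ler_normc_dist.
Qed.

Lemma C0_bounded f : exists M : R, forall x, normc (f x) <= M.
Proof.
have [K cK fK] := C0_vanishing f ltr01.
have /compact_bounded[M [_ fM]] : compact ((fun x => normc (f x) : R) @` K).
  apply: continuous_compact cK.
  exact/continuous_subspaceT/C0_normc_continuous.
exists (Num.max 1 (M + 1)) => x; rewrite le_max.
have [Kx|/fK/ltW->//] := pselect (K x).
rewrite (le_trans (ler_norm _) (fM (M + 1) _ _ _)) ?orbT ?ltrDl//.
by exists x.
Qed.

Lemma normc_le_C0_norm f x : normc (f x) <= C0_norm f.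
Proof.
have [M fM] := C0_bounded f.
by apply: ub_le_sup; [exists M => _ [y _ <-]|exists x].
Qed.

Lemma C0_norm_le f (M : R) : 0 <= M -> (forall x, normc (f x) <= M) ->
  C0_norm f <= M.
Proof.
move=> M0 fM; rewrite /C0_norm.
have [->|/set0P ne] := eqVneq [set normc (f x) | x in [set: X]] set0.
  by rewrite sup0.
by apply: ge_sup => // _ [x _ <-].
Qed.

Lemma C0_norm_ge0 f : 0 <= C0_norm f.
Proof.
have [E0|/set0P[_ [x _ _]]] := eqVneq [set normc (f x) | x in [set: X]] set0.
  by rewrite /C0_norm E0 sup0.
exact: le_trans (normc_ge0 _) (normc_le_C0_norm f x).
Qed.

Lemma C0_normD f g : C0_norm (f + g) <= C0_norm f + C0_norm g.
Proof.
apply: C0_norm_le => [|x]; first by rewrite addr_ge0 ?C0_norm_ge0.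
by rewrite (le_trans (ler_normcD _ _))// lerD ?normc_le_C0_norm.
Qed.

Lemma C0_normZ (k : R[i]) f : C0_norm (k *: f) = normc k * C0_norm f.
Proof.
have le (l : R[i]) g : C0_norm (l *: g) <= normc l * C0_norm g.
  apply: C0_norm_le => [|x]; first by rewrite mulr_ge0 ?normc_ge0 ?C0_norm_ge0.
  by rewrite /= normcM ler_wpM2l ?normc_ge0 ?normc_le_C0_norm.
apply/eqP; rewrite eq_le le /=.
have [->|k0] := eqVneq k 0; first by rewrite normc0 mul0r C0_norm_ge0.
have nk0 : 0 < normc k.
  by rewrite lt_neqAle normc_ge0 andbT eq_sym; apply: contraNneq k0 => /eq0_normc->.
rewrite -ler_pdivlMl// -normcV (le_trans _ (le _ _))// scalerA mulVf//.
by rewrite scale1r.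
Qed.

Lemma C0_norm_eq0 f : C0_norm f = 0 -> f = 0.
Proof.
move=> f0; apply: C0P => x; apply: eq0_normc; apply/eqP.
by rewrite eq_le normc_ge0 andbT -f0 normc_le_C0_norm.
Qed.

Lemma C0_norm0 : C0_norm 0 = 0.
Proof. by rewrite -(scale0r 0) C0_normZ normc0 mul0r. Qed.

Fact C0_normCD f g : (C0_norm (f + g))%:C <= (C0_norm f)%:C + (C0_norm g)%:C.
Proof. by rewrite -rmorphD lecR C0_normD. Qed.
Fact C0_normCZ (k : R[i]) f : (C0_norm (k *: f))%:C = `|k| * (C0_norm f)%:C.
Proof. by rewrite C0_normZ rmorphM. Qed.
Fact C0_normC_eq0 f : (C0_norm f)%:C = 0 -> f = 0.
Proof. by move=> /(congr1 (@complex.Re R))/= /C0_norm_eq0. Qed.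

HB.instance Definition _ := @Lmodule_isNormed.Build R[i] (C0 R X)
  (fun f => (C0_norm f)%:C) C0_normCD C0_normCZ C0_normC_eq0.

Lemma C0_normE f : `|f| = (C0_norm f)%:C.
Proof. by []. Qed.

Lemma C0_mul_continuous f g : continuous (fun x => f x * g x).
Proof. by move=> x; apply: cvgM; exact: C0_continuous. Qed.

Lemma C0_mul_vanishing f g : vanishes_at_infinity (fun x => f x * g x).
Proof.
apply: (vanishes_dominated (C0_norm_ge0 f) _ (@C0_vanishing _ _ g)) => x.
by rewrite normcM ler_wpM2r ?normc_ge0 ?normc_le_C0_norm.
Qed.

Definition C0_mul f g : C0 R X :=
  MkC0 (@C0_mul_continuous f g) (@C0_mul_vanishing f g).

Lemma C0_normM f g : C0_norm (C0_mul f g) <= C0_norm f * C0_norm g.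
Proof.
apply: C0_norm_le => [|x]; first by rewrite mulr_ge0 ?C0_norm_ge0.
by rewrite /= normcM ler_pM ?normc_ge0 ?normc_le_C0_norm.
Qed.

Variable s : homeomorphism X.

Lemma C0_comp_continuous f : continuous (f \o homeo_inv s).
Proof.
by move=> x; apply: continuous_comp; [exact: homeo_inv_continuous|exact: C0_continuous].
Qed.

Lemma C0_comp_vanishing f : vanishes_at_infinity (f \o homeo_inv s).
Proof.
move=> e /(C0_vanishing f)[K cK fK]; exists (s @` K).
  apply: continuous_compact cK.
  exact/continuous_subspaceT/homeo_continuous.
by move=> x sKx; apply: fK => Kx; apply: sKx; exists (homeo_inv s x);
  rewrite ?homeo_invK.
Qed.

Definition sigma_hat f : C0 R X :=
  MkC0 (@C0_comp_continuous f) (@C0_comp_vanishing f).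

Lemma C0_norm_sigma_hat f : C0_norm (sigma_hat f) <= C0_norm f.
Proof. by apply: C0_norm_le (C0_norm_ge0 f) _ => x; exact: (normc_le_C0_norm f). Qed.

End C0Theory.

(* The powers of sigma_hat; the inverse of sigma_hat s is the automorphism     *)
(* induced by the inverse homeomorphism.                                      *)
Definition sigma_hat_pow (R : realType) (X : topologicalType)
    (s : homeomorphism X) (n : int) : C0 R X -> C0 R X :=
  match n with
  | Posz k => iter k (sigma_hat s)
  | Negz k => iter k.+1 (sigma_hat (homeo_sym s))
  end.

Lemma C0_norm_sigma_hat_pow (R : realType) (X : topologicalType)
    (s : homeomorphism X) (n : int) (f : C0 R X) :
  C0_norm (sigma_hat_pow s n f) <= C0_norm f.
Proof.
by case: n => n; rewrite /sigma_hat_pow; [elim: n|elim: n.+1] => //= k IH;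
  exact: le_trans (C0_norm_sigma_hat _ _) IH.
Qed.

(* The terms of indices k and -(k+1) are grouped together: in the twisted      *)
(* convolution the series converges absolutely, so the order is immaterial.   *)
Definition zseries (K : numFieldType) (V : normedModType K) (u : int -> V) : V :=
  limn (series (fun k : nat => u (Posz k) + u (Negz k))).

Lemma zseries_norm_le (R : realType) (X : topologicalType)
    (u : int -> C0 R X) :
  ((C0_norm (zseries u))%:E <= \esum_(k in [set: int]) (C0_norm (u k))%:E)%E.
Proof.
set E := (\esum_(k in _) _)%E.
have E_ge (r : seq int) : uniq r ->
    ((\sum_(k <- r) C0_norm (u k))%:E <= E)%E.
  move=> ur; apply: esum_ge; exists [set` r].
    by split => //; exact: finite_seq.
  by rewrite -fsbig_seq// sumEFin.
have : (0 <= E)%E by apply: esum_ge0 => k _; rewrite lee_fin C0_norm_ge0.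
case EE : E => [t| |] // t0; last by rewrite leey.
rewrite lee_fin in t0 *; rewrite /zseries; set v := series _.
have vt n : C0_norm (v n) <= t.
  have : ((\sum_(k <- [seq Posz k | k <- iota 0 n] ++
                      [seq Negz k | k <- iota 0 n]) C0_norm (u k))%:E <= E)%E.
    apply: E_ge; rewrite cat_uniq !map_inj_uniq ?iota_uniq//=; try by move=> ? ? [].
    by rewrite andbT; apply/hasPn => _ /mapP[j _ ->]; apply/mapP => -[].
  rewrite EE lee_fin; apply: le_trans.
  rewrite big_cat /= !big_map -big_split /= /v /series /= /index_iota subn0.
  elim: (iota 0 n) => [|k l IH]; first by rewrite !big_nil C0_norm0.
  rewrite !big_cons (le_trans (C0_normD _ _))// lerD//.
  exact: C0_normD.
have [vl|nv] := pselect (cvgn v); last first.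
  by rewrite (dvgP nv) (_ : point = 0) ?C0_norm0.
apply/ler_addgt0Pr => e e0; set l := limn v.
have e0C : 0 < e%:C :> R[i] by rewrite ltcR.
have /cvgrPdist_lt/(_ _ e0C)[n _ /(_ n (leqnn n))] : v @ \oo --> l by [].
rewrite /= C0_normE ltcR => ln.
rewrite -[l](subrK (v n)) (le_trans (C0_normD _ _))// addrC lerD//.
exact: ltW.
Qed.

Record ell1 (R : realType) (X : topologicalType) := MkEll1 {
  ell1_coef :> int -> C0 R X;
  ell1_summable :
    (\esum_(n in [set: int]) (C0_norm (ell1_coef n))%:E < +oo)%E;
}.

Section Ell1Theory.
Variables (R : realType) (X : topologicalType).
Implicit Types (a b c : ell1 R X) (u v : int -> C0 R X).

Let esum_norm u : \bar R := (\esum_(n in [set: int]) (C0_norm (u n))%:E)%E.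

Lemma esum_norm_ge0 u : (0 <= esum_norm u)%E.
Proof. by apply: esum_ge0 => n _; rewrite lee_fin C0_norm_ge0. Qed.

Lemma esum_normZl_le (r : R) (x : int -> R) : 0 <= r -> (forall n, 0 <= x n) ->
  (\esum_(n in [set: int]) (r * x n)%:E <=
   r%:E * \esum_(n in [set: int]) (x n)%:E)%E.
Proof.
move=> r0 x0; apply: ge_ereal_sup => _ [F [finF FT] <-].
have -> : (\sum_(n \in F) (r * x n)%:E = r%:E * \sum_(n \in F) (x n)%:E)%E.
  by rewrite ge0_mule_fsumr// => n; rewrite lee_fin.
by apply: lee_wpmul2l; rewrite ?lee_fin//; apply: ereal_sup_ubound; exists F.
Qed.

Lemma ell1P a b : a =1 b -> a = b.
Proof.
case: a b => [u su] [v sv] /= /funext uv; subst v.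
by rewrite (Prop_irrelevance su sv).
Qed.

HB.instance Definition _ := gen_eqMixin (ell1 R X).
HB.instance Definition _ := gen_choiceMixin (ell1 R X).

Fact ell1_zero_summable : (esum_norm (fun=> 0%R) < +oo)%E.
Proof. by rewrite /esum_norm esum1 ?ltry// => n _; rewrite C0_norm0. Qed.

Lemma esum_normD u v : (esum_norm (fun n => u n + v n)%R <= esum_norm u + esum_norm v)%E.
Proof.
rewrite /esum_norm -esumD => [|n _|n _]; rewrite ?lee_fin ?C0_norm_ge0//.
by apply: le_esum => n _; rewrite -EFinD lee_fin C0_normD.
Qed.

Fact ell1_add_summable a b : (esum_norm (fun n => a n + b n)%R < +oo)%E.
Proof.
by rewrite (le_lt_trans (esum_normD a b))// lte_add_pinfty ?ell1_summable.
Qed.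

Lemma esum_normZ (k : R[i]) u :
  (esum_norm (fun n => k *: u n)%R <= (normc k)%:E * esum_norm u)%E.
Proof.
apply: le_trans (esum_normZl_le (normc_ge0 k) (fun n => C0_norm_ge0 (u n))).
by apply: le_esum => n _; rewrite C0_normZ.
Qed.

Fact ell1_scale_summable (k : R[i]) a : (esum_norm (fun n => k *: a n)%R < +oo)%E.
Proof.
rewrite (le_lt_trans (esum_normZ k a))// lte_mul_pinfty ?lee_fin ?normc_ge0//.
exact: ell1_summable.
Qed.

Definition ell1_zero : ell1 R X := MkEll1 ell1_zero_summable.
Definition ell1_add a b : ell1 R X := MkEll1 (ell1_add_summable a b).
Definition ell1_scale (k : R[i]) a : ell1 R X := MkEll1 (ell1_scale_summable k a).
Definition ell1_opp a : ell1 R X := ell1_scale (-1) a.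

Fact ell1_addA : associative ell1_add.
Proof. by move=> a b c; apply: ell1P => n /=; rewrite addrA. Qed.
Fact ell1_addC : commutative ell1_add.
Proof. by move=> a b; apply: ell1P => n /=; rewrite addrC. Qed.
Fact ell1_add0 : left_id ell1_zero ell1_add.
Proof. by move=> a; apply: ell1P => n /=; rewrite add0r. Qed.
Fact ell1_addN : left_inverse ell1_zero ell1_opp ell1_add.
Proof. by move=> a; apply: ell1P => n /=; rewrite scaleN1r addNr. Qed.

HB.instance Definition _ :=
  GRing.isZmodule.Build (ell1 R X) ell1_addA ell1_addC ell1_add0 ell1_addN.

Fact ell1_scaleA (k l : R[i]) a :
  ell1_scale k (ell1_scale l a) = ell1_scale (k * l) a.
Proof. by apply: ell1P => n /=; rewrite scalerA. Qed.
Fact ell1_scale1 : left_id 1 ell1_scale.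
Proof. by move=> a; apply: ell1P => n /=; rewrite scale1r. Qed.
Fact ell1_scaleDr : right_distributive ell1_scale +%R.
Proof. by move=> k a b; apply: ell1P => n /=; rewrite scalerDr. Qed.
Fact ell1_scaleDl a (k l : R[i]) :
  ell1_scale (k + l) a = ell1_scale k a + ell1_scale l a.
Proof. by apply: ell1P => n /=; rewrite scalerDl. Qed.

HB.instance Definition _ := GRing.Zmodule_isLmodule.Build R[i] (ell1 R X)
  ell1_scaleA ell1_scale1 ell1_scaleDr ell1_scaleDl.

Definition ell1_norm a : R :=
  fine (\esum_(n in [set: int]) (C0_norm (a n))%:E)%E.

Lemma ell1_normE a : (ell1_norm a)%:E = esum_norm a.
Proof. by rewrite fineK// ge0_fin_numE ?esum_norm_ge0 ?ell1_summable. Qed.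

Lemma ell1_norm_ge0 a : 0 <= ell1_norm a.
Proof. by rewrite -lee_fin ell1_normE esum_norm_ge0. Qed.

Lemma C0_norm_le_ell1_norm a n : C0_norm (a n) <= ell1_norm a.
Proof.
rewrite -lee_fin ell1_normE; apply: esum_ge; exists [set n].
  by split => //; exact: finite_set1.
by rewrite fsbig_set1.
Qed.

Lemma ell1_normD a b : ell1_norm (a + b) <= ell1_norm a + ell1_norm b.
Proof. by rewrite -lee_fin EFinD !ell1_normE esum_normD. Qed.

Lemma ell1_normZ (k : R[i]) a : ell1_norm (k *: a) = normc k * ell1_norm a.
Proof.
have le (l : R[i]) b : ell1_norm (l *: b) <= normc l * ell1_norm b.
  by rewrite -lee_fin EFinM !ell1_normE esum_normZ.
apply/eqP; rewrite eq_le le /=.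
have [->|k0] := eqVneq k 0; first by rewrite normc0 mul0r ell1_norm_ge0.
have nk0 : 0 < normc k.
  by rewrite lt_neqAle normc_ge0 andbT eq_sym; apply: contraNneq k0 => /eq0_normc->.
rewrite -ler_pdivlMl// -normcV (le_trans _ (le _ _))// scalerA mulVf//.
by rewrite scale1r.
Qed.

Lemma ell1_norm_eq0 a : ell1_norm a = 0 -> a = 0.
Proof.
move=> a0; apply: ell1P => n; apply: C0_norm_eq0; apply/eqP.
by rewrite eq_le C0_norm_ge0 andbT -a0 C0_norm_le_ell1_norm.
Qed.

Fact ell1_normCD a b : (ell1_norm (a + b))%:C <= (ell1_norm a)%:C + (ell1_norm b)%:C.
Proof. by rewrite -rmorphD lecR ell1_normD. Qed.
Fact ell1_normCZ (k : R[i]) a : (ell1_norm (k *: a))%:C = `|k| * (ell1_norm a)%:C.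
Proof. by rewrite ell1_normZ rmorphM. Qed.
Fact ell1_normC_eq0 a : (ell1_norm a)%:C = 0 -> a = 0.
Proof. by move=> /(congr1 (@complex.Re R))/= /ell1_norm_eq0. Qed.

HB.instance Definition _ := @Lmodule_isNormed.Build R[i] (ell1 R X)
  (fun a => (ell1_norm a)%:C) ell1_normCD ell1_normCZ ell1_normC_eq0.

Variable s : homeomorphism X.

Definition conv_coef a b (n : int) : C0 R X :=
  zseries (fun k => C0_mul (a k) (sigma_hat_pow s k (b (n - k)))).

Lemma conv_summable a b : (esum_norm (conv_coef a b) < +oo)%E.
Proof.
pose F (n k : int) : \bar R := (C0_norm (a k) * C0_norm (b (n - k)))%:E.
have F0 n k : (0 <= F n k)%E by rewrite lee_fin mulr_ge0 ?C0_norm_ge0.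
have leF : (esum_norm (conv_coef a b) <=
    \esum_(n in [set: int]) \esum_(k in [set: int]) F n k)%E.
  apply: le_esum => n _; apply: le_trans (zseries_norm_le _) _.
  apply: le_esum => k _; rewrite lee_fin (le_trans (C0_normM _ _))//.
  by rewrite ler_wpM2l ?C0_norm_ge0 ?C0_norm_sigma_hat_pow.
apply: le_lt_trans leF _.
have -> : (\esum_(n in [set: int]) \esum_(k in [set: int]) F n k =
    \esum_(k in [set: int]) \esum_(n in [set: int]) F n k)%E.
  rewrite !esum_esum//.
  rewrite (reindex_esum ([set: int] `*`` (fun=> [set: int]))
             ([set: int] `*`` (fun=> [set: int])) (fun p : int * int => (p.2, p.1)))//.
  by split=> [//|[? ?] [? ?] _ _ [-> ->]//|[i j] _]; exists (j, i).
have inner (k : int) : (\esum_(n in [set: int]) F n k <=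
    (ell1_norm b * C0_norm (a k))%:E)%E.
  apply: le_trans (esum_normZl_le (C0_norm_ge0 (a k)) _) _ => [n|].
    exact: C0_norm_ge0.
  rewrite mulrC EFinM lee_wpmul2l ?lee_fin ?C0_norm_ge0// ell1_normE /esum_norm.
  rewrite [leRHS](reindex_esum [set: int] [set: int] (fun n : int => n - k))//.
  split=> [//|n m _ _ /addIr//|n _]; exists (n + k) => //.
  by rewrite addrK.
apply: le_lt_trans (le_esum (fun k _ => inner k)) _.
apply: le_lt_trans (esum_normZl_le (ell1_norm_ge0 b) _) _ => [k|].
  exact: C0_norm_ge0.
by rewrite lte_mul_pinfty ?lee_fin ?ell1_norm_ge0// ell1_summable.
Qed.

Definition conv a b : ell1 R X := MkEll1 (conv_summable a b).

Definition monomial_coef (f : C0 R X) (n m : int) : C0 R X :=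
  if m == n then f else 0.

Lemma monomial_summable f n : (esum_norm (monomial_coef f n) < +oo)%E.
Proof.
rewrite /esum_norm (_ : (\esum_(m in _) _)%E =
  (\esum_(m in [set n]) (C0_norm f)%:E)%E).
  by rewrite esum_set1 ?ltry// lee_fin C0_norm_ge0.
rewrite [RHS]esum_mkcond; apply: eq_esum => m _; rewrite /monomial_coef.
by rewrite in_set1; case: ifP => // _; rewrite C0_norm0.
Qed.

Definition monomial f n : ell1 R X := MkEll1 (monomial_summable f n).

Lemma zseries1 (u : int -> C0 R X) n : (forall k, k != n -> u k = 0) ->
  zseries u = u n.
Proof.
move=> u0; apply: lim_near_cst; first exact: norm_hausdorff.
have [j jn] : exists j : nat, n = Posz j \/ n = Negz j.
  by case: (n) => j; exists j; [left|right].
near=> N; have jN : (j < N)%N by near: N; exact: nbhs_infty_gt.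
rewrite /series /= big_mkord (bigD1 (Ordinal jN))//= big1 => [|k kj].
  by case: jn u0 => -> u0; rewrite addr0;
    [rewrite (u0 (Negz j)) ?addr0|rewrite (u0 (Posz j)) ?add0r].
have {}kj : (k : nat) != j by [].
by case: jn u0 => -> u0; rewrite !u0 ?addr0//; apply: contra_neq kj => -[].
Unshelve. all: by end_near. Qed.

Lemma C0_mul0 f : C0_mul f 0 = 0 :> C0 R X.
Proof. by apply: C0P => x /=; rewrite mulr0. Qed.

Lemma C0_mul0l f : C0_mul (0 : C0 R X) f = 0.
Proof. by apply: C0P => x /=; rewrite mul0r. Qed.

Lemma sigma_hat_pow0 n : sigma_hat_pow s n (0 : C0 R X) = 0.
Proof.
by case: n => n; rewrite /sigma_hat_pow; [elim: n|elim: n.+1] => //= k ->;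
  apply: C0P.
Qed.

Lemma conv_monomial f g n m :
  conv (monomial f n) (monomial g m) =
  monomial (C0_mul f (sigma_hat_pow s n g)) (n + m).
Proof.
apply: ell1P => l /=; rewrite /conv_coef (zseries1 (n := n)) => [|k kn].
  rewrite /= /monomial_coef eqxx subr_eq addrC.
  by case: ifP => // _; rewrite sigma_hat_pow0 C0_mul0.
by rewrite /= /monomial_coef (negbTE kn) C0_mul0l.
Qed.

End Ell1Theory.

Section CommutatorIdeal.
Variables (R : realType) (X : topologicalType) (s : homeomorphism X).

Definition two_sided_ideal (I : set (ell1 R X)) : Prop :=
  [/\ I 0,
      forall a b, I a -> I b -> I (a + b),
      forall (k : R[i]) a, I a -> I (k *: a),
      forall a b, I b -> I (conv s a b) &
      forall a b, I a -> I (conv s a b)].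

Definition closed_commutator_ideal : set (ell1 R X) :=
  \bigcap_(I in [set I : set (ell1 R X) |
    [/\ two_sided_ideal I, closed I &
        forall a b, I (conv s a b - conv s b a)]]) I.

Definition Per1 : set X := [set x | s x = x].

Definition Ker (S : set X) : set (ell1 R X) :=
  [set a : ell1 R X | forall (n : int) x, S x -> a n x = 0].

End CommutatorIdeal.

Arguments closed_commutator_ideal R {X} s.
Arguments Ker R {X} S.

(* Main.v *)
Require Import Defs.
From mathcomp Require Import all_boot all_order all_algebra.
From mathcomp Require Import complex.
From mathcomp Require Import all_classical all_reals all_analysis ring.
(* Imported again so that [conv] is the convolution, not a convex combination. *)
Require Import Defs.

Set Implicit Arguments.
Unset Strict Implicit.
Unset Printing Implicit Defensive.

Import Order.TTheory GRing.Theory Num.Theory.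
Import numFieldNormedType.Exports.
Import ComplexField.Normc.

Local Open Scope classical_set_scope.
Local Open Scope complex_scope.
Local Open Scope ring_scope.

(** The statement holds for every homeomorphism s of a space X whose points are
    separated by continuous complex functions; on the spectrum these are the
    evaluations at elements of A.

    The commutator ideal lies in the kernel of the fixed points because that
    kernel is a closed ideal containing all commutators. At a fixed point x the
    twist disappears, so two monomials commute there, and the commutator of
    arbitrary elements follows by density: the functional that sends a to the
    value at x of a coefficient of a * b - b * a is additive and bounded and
    kills monomials (commutator_fixed_point). Additivity rests on the norm
    convergence of the twisted convolution, that is, on the completeness of
    C0(X) (C0_series_cvg).

    Conversely, let I be a closed ideal containing the commutators. By density
    it is enough to show that f delta^n is in I when f vanishes on the fixed
    points. The f with f delta^n in I form a closed ideal of C0(X), which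
    contains g (h - h o s^-1) (k o s^-1) for all g, h, k: multiply the
    commutator of h and g delta by k delta^(n-1) (commutator_ideal_coef). If
    f x != 0, then s^-1 x != x, and g, h, k can be built from f and a function
    separating x from s^-1 x so that this product does not vanish at x. Hence
    the ideal has no common zero where f is nonzero, and compactness of the sets
    where |f| is bounded below lets f be approximated by elements of the ideal
    (C0_ideal_approx), the usual local argument for closed ideals of C0(X). *)

(** * Completeness of C0(X) *)

Section C0Complete.
Variables (R : realType) (X : topologicalType).
Implicit Types (f g : C0 R X) (u : int -> C0 R X).

Lemma gt0_complexP (e : R[i]) : 0 < e -> exists2 r : R, 0 < r & e = r%:C.
Proof.
rewrite ltcE => /andP[/eqP/= e0 e1]; exists (complex.Re e) => //.
by case: e e0 e1 => a b /= ->.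
Qed.

(** Convergence over the complex numbers is defined with complex epsilons, but
    the positive ones are real. *)
Lemma cvgr_real_dist (V : normedModType R[i]) (F : set_system V)
    {FF : Filter F} (y : V) :
  (forall e : R, 0 < e -> \forall x \near F, `|y - x| < e%:C) -> F --> y.
Proof. by move=> h; apply/cvgrPdist_lt => _ /gt0_complexP[e e0 ->]; exact: h. Qed.

Lemma continuous_normcP (T : topologicalType) (h : T -> R[i]) :
  continuous h <->
  (forall t (e : R), 0 < e -> \forall y \near t, normc (h t - h y) < e).
Proof.
split=> [ch t e e0|hh t].
  have e0C : 0 < e%:C :> R[i] by rewrite ltcR.
  have /cvgrPdist_lt/(_ _ e0C) := ch t.
  by apply: filterS => y; rewrite normcE ltcR.
apply/cvgrPdist_lt => _ /gt0_complexP[e e0 ->].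
by apply: filterS (hh t e e0) => y; rewrite normcE ltcR.
Qed.

Lemma normc_distC (y z : R[i]) : normc (y - z) = normc (z - y).
Proof. by apply: complexI; rewrite -!normcE distrC. Qed.

Lemma Re_le_normc (z : R[i]) : `|complex.Re z| <= normc z.
Proof. by have := normc_ge_Re z; rewrite normcE lecR. Qed.

Lemma Im_le_normc (z : R[i]) : `|complex.Im z| <= normc z.
Proof.
case: z => a b /=; rewrite -(@ler_pXn2r _ 2) ?nnegrE ?sqrtr_ge0//.
by rewrite sqr_sqrtr ?addr_ge0 ?sqr_ge0// real_normK ?num_real// lerDr sqr_ge0.
Qed.

Lemma normc_le_ReIm (z : R[i]) : normc z <= `|complex.Re z| + `|complex.Im z|.
Proof.
case: z => a b /=; rewrite -(@ler_pXn2r _ 2) ?nnegrE ?sqrtr_ge0 ?addr_ge0//.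
rewrite sqr_sqrtr ?addr_ge0 ?sqr_ge0// sqrrD !real_normK ?num_real//.
by rewrite addrAC lerDl mulrn_wge0 ?mulr_ge0.
Qed.

Lemma C0_uniform_limit (h : X -> R[i]) :
  (forall e : R, 0 < e -> exists g, forall x, normc (h x - g x) < e) ->
  continuous h /\ vanishes_at_infinity h.
Proof.
move=> hg; split=> [|e e0].
  apply/continuous_normcP => t e e0.
  have e3 : 0 < e / 3 by rewrite divr_gt0.
  have [g gh] := hg _ e3.
  have /continuous_normcP/(_ t _ e3) := @C0_continuous _ _ g.
  apply: filterS => y gty.
  have -> : h t - h y = (h t - g t) + (g t - g y) + (g y - h y).
    by rewrite !addrA !subrK.
  rewrite (le_lt_trans (ler_normcD _ _))//.
  have -> : e = e / 3 + e / 3 + e / 3 by field.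
  apply: ltrD; last by rewrite normc_distC.
  by rewrite (le_lt_trans (ler_normcD _ _))// ltrD.
have e2 : 0 < e / 2 by rewrite divr_gt0.
have [g gh] := hg _ e2; have [K cK Kg] := C0_vanishing g e2.
exists K => // x nKx; rewrite -[h x](subrK (g x)).
by rewrite (le_lt_trans (ler_normcD _ _))// (splitr e) ltrD ?gh ?Kg.
Qed.

(** Completeness of C0(X), in the form of the Weierstrass test. The pointwise
    limit is assembled from the real and imaginary parts, which are absolutely
    convergent real series; bounding each part by the tail of the dominating
    series makes the convergence uniform. *)
Lemma C0_series_cvg (w : nat -> C0 R X) (W : nat -> R) :
  (forall k, C0_norm (w k) <= W k) -> cvgn (series W) -> cvgn (series w).
Proof.
move=> wW cW; set T := limn (series W).
have W0 k : 0 <= W k by exact: le_trans (C0_norm_ge0 _) (wW k).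
have serE n x : series w n x = series (fun k => w k x) n.
  by rewrite /series /=; elim/big_ind2 : _ => // _ f _ g <- <-.
have [fe fP] : exists h : X -> R[i], forall x n,
    normc (h x - series w n x) <= 2 * (T - series W n).
  have part (p : R[i] -> R) : {morph p : y z / y + z} -> p 0 = 0 ->
      (forall z, `|p z| <= normc z) ->
      exists h : X -> R, forall x n, `|h x - p (series w n x)| <= T - series W n.
    move=> pD p0 ple.
    have pW x k : `|p (w k x)| <= W k.
      exact: le_trans (ple _) (le_trans (normc_le_C0_norm _ _) (wW k)).
    have cp x : cvgn (series (fun k => p (w k x))).
      apply: normed_cvg; apply: series_le_cvg W0 (pW x) cW => k /=; exact: normr_ge0.
    exists (fun x => limn (series (fun k => p (w k x)))) => x n.
    have -> : p (series w n x) = series (fun k => p (w k x)) n.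
      by rewrite serE /series /= (big_morph p pD p0).
    have cS : (fun m => `|series (fun k => p (w k x)) m -
                 series (fun k => p (w k x)) n|) @ \oo -->
        `|limn (series (fun k => p (w k x))) - series (fun k => p (w k x)) n|.
      by apply: cvg_norm; apply: cvgB; [exact: cp|exact: cvg_cst].
    have cT : (fun m => series W m - series W n) @ \oo --> T - series W n.
      by apply: cvgB; [exact: cW|exact: cvg_cst].
    apply: (ler_cvg_to cS cT); exists n => // m /= nm.
    rewrite !sub_series_geq//.
    by apply: le_trans (ler_norm_sum _ _ _) _; apply: ler_sum.
  have [hr hrP] := part (@complex.Re R)
    (fun '(a +i* b) '(c +i* d) => erefl) erefl Re_le_normc.
  have [hi hiP] := part (@complex.Im R)
    (fun '(a +i* b) '(c +i* d) => erefl) erefl Im_le_normc.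
  exists (fun x => hr x +i* hi x) => x n.
  rewrite (le_trans (normc_le_ReIm _))// mulr_natl mulr2n lerD//.
    by move: (hrP x n); case: (series w n x).
  by move: (hiP x n); case: (series w n x).
have small (e : R) : 0 < e -> \forall n \near \oo,
    forall x, normc (fe x - series w n x) < e.
  move=> e0; have e2 : 0 < e / 2 by rewrite divr_gt0.
  have /cvgrPdist_lt/(_ _ e2) : series W @ \oo --> T by [].
  apply: filterS => n Tn x; rewrite (le_lt_trans (fP x n))//.
  by rewrite mulrC -ltr_pdivlMr// (le_lt_trans (ler_norm _)).
have [fc fv] : continuous fe /\ vanishes_at_infinity fe.
  apply: C0_uniform_limit => e /small[n _ /(_ n (leqnn n))] /= wn.
  by exists (series w n).
suff : series w @ \oo --> MkC0 fc fv by apply: cvgP.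
apply: cvgr_real_dist => e e0; have e2 : 0 < e / 2 by rewrite divr_gt0.
apply: filterS (small _ e2) => n wn; rewrite /= C0_normE ltcR.
rewrite (@le_lt_trans _ _ (e / 2)) ?ltr_pdivrMr ?ltr_pMr ?ltr1n//.
apply: C0_norm_le => [|x]; first exact: ltW.
by rewrite /= mulN1r ltW.
Qed.

(** Since [zseries] takes a default value on divergent series, this is what
    makes the coefficients of a twisted convolution genuine sums. *)
Lemma zseries_cvg u : (\esum_(k in [set: int]) (C0_norm (u k))%:E < +oo)%E ->
  series (fun k : nat => u (Posz k) + u (Negz k)) @ \oo --> zseries u.
Proof.
set E := (\esum_(k in _) _)%E => Eoo.
have : (0 <= E)%E by apply: esum_ge0 => k _; rewrite lee_fin C0_norm_ge0.
case EE : E Eoo => [t| |] // _ _.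
apply: (@C0_series_cvg _ (fun k => C0_norm (u (Posz k)) + C0_norm (u (Negz k)))).
  by move=> k; exact: C0_normD.
apply: nondecreasing_is_cvgn.
  apply/nondecreasing_seqP => n; rewrite /series /= big_nat_recr//= lerDl.
  by rewrite addr_ge0 ?C0_norm_ge0.
exists t => _ [n _ <-]; rewrite -lee_fin -EE /E.
apply: esum_ge; exists [set` [seq Posz k | k <- iota 0 n] ++
                      [seq Negz k | k <- iota 0 n]].
  by split => //; exact: finite_seq.
rewrite -fsbig_seq; last first.
  rewrite cat_uniq !map_inj_uniq ?iota_uniq//=; try by move=> ? ? [].
  by rewrite andbT; apply/hasPn => _ /mapP[j _ ->]; apply/mapP => -[].
by rewrite sumEFin lee_fin big_cat /= !big_map -big_split /= /series /=
  /index_iota subn0.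
Qed.

End C0Complete.

(** * Approximation by monomials *)

Section Ell1Approximation.
Variables (R : realType) (X : topologicalType).
Implicit Types (a b : ell1 R X) (I : set (ell1 R X)).

Lemma closure_ell1P I a :
  closure I a <-> forall e : R, 0 < e -> exists2 b, I b & ell1_norm (a - b) < e.
Proof.
split=> [cIa e e0|Ia B /nbhs_normP[_ /gt0_complexP[e e0 ->] aB]].
  have e0C : 0 < e%:C :> R[i] by rewrite ltcR.
  have [b [Ib ab]] := cIa _ (nbhsx_ballx a _ e0C).
  by exists b => //; move: ab; rewrite -ball_normE /= ltcR.
have [b Ib ab] := Ia e e0; exists b; split => //; apply: aB.
by rewrite /= ltcR.
Qed.

Lemma ell1_sum_coef (r : seq int) (F : int -> ell1 R X) (n : int) :
  (\sum_(k <- r) F k) n = \sum_(k <- r) F k n.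
Proof. exact: (big_morph (fun a : ell1 R X => a n)). Qed.

(** The finite set [F] nearly exhausts the norm of [a], and the norm of the
    difference is what remains outside [F]. *)
Lemma ell1_monomial_approx a (e : R) : 0 < e ->
  exists r : seq int, ell1_norm (a - \sum_(k <- r) monomial (a k) k) < e.
Proof.
move=> e0; pose u (k : int) : \bar R := (C0_norm (a k))%:E.
have u0 k : (0 <= u k)%E by rewrite lee_fin C0_norm_ge0.
have : ((ell1_norm a - e)%:E < \esum_(k in [set: int]) u k)%E.
  by rewrite -ell1_normE lte_fin ltrBlDr ltrDl.
move=> /ereal_sup_gt[_ [F [finF _] <-] aF].
have /finite_fsetP[A FA] := finF; exists (finmap.enum_fset A).
set b := a - _.
have bE k : C0_norm (b k) = if k \in ~` F then C0_norm (a k) else 0.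
  rewrite /b /= ell1_sum_coef.
  have [kF|kF] := boolP (k \in ~` F).
    rewrite big_seq big1 ?oppr0 ?scaler0 ?addr0// => i iA.
    rewrite /= /monomial_coef; case: eqP => // ki; subst i.
    by move: kF; rewrite inE; case; rewrite FA.
  have kA : k \in finmap.enum_fset A.
    by move: kF; rewrite notin_setE; apply: contra_notT; rewrite FA => /negP.
  rewrite (bigD1_seq k)//= ?finmap.fset_uniq// big1 => [|i ik].
    by rewrite addr0 /monomial_coef eqxx scaleN1r subrr C0_norm0.
  by rewrite /= /monomial_coef eq_sym (negbTE ik).
have bT : (ell1_norm b)%:E = (\esum_(k in ~` F) u k)%E.
  rewrite ell1_normE [RHS]esum_mkcond; apply: eq_esum => k _.
  by rewrite bE; case: ifP.
have aT : (ell1_norm a)%:E = (\sum_(k \in F) u k + (ell1_norm b)%:E)%E.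
  transitivity (\esum_(k in [set: int]) u k)%E; first by rewrite ell1_normE.
  by rewrite bT (esumID F)// !setTI esum_fset.
move: aF aT; case: (\sum_(k \in F) u k)%E => [t| |]//.
rewrite lte_fin -EFinD => aF [aT].
by move: aF; rewrite aT ltrBlDr ltrD2l.
Qed.

Lemma closed_add_monomial_sub I a : closed I -> I 0 ->
  (forall b c, I b -> I c -> I (b + c)) ->
  (forall k, I (monomial (a k) k)) -> I a.
Proof.
move=> cI I0 ID Ia; apply: cI; apply/closure_ell1P => e e0.
have [r ar] := ell1_monomial_approx a e0.
by exists (\sum_(k <- r) monomial (a k) k) => //; elim/big_ind: _.
Qed.

(** The density of finite sums of monomials, for functionals rather than
    subspaces: D a is the value of D on an arbitrarily small remainder. *)
Lemma ell1_functional_eq0 (D : ell1 R X -> R[i]) (M : R) a :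
  {morph D : b c / b + c} -> (forall b, normc (D b) <= M * ell1_norm b) ->
  (forall k, D (monomial (a k) k) = 0) -> D a = 0.
Proof.
move=> DD DM Da.
have D0 : D 0 = 0 by apply: (addrI (D 0)); rewrite -DD !addr0.
have M0 : 0 <= `|M| by [].
apply: eq0_normc; apply/eqP; rewrite eq_le normc_ge0 andbT.
apply/ler_addgt0Pr => e e0; rewrite add0r.
have e1 : 0 < e / (`|M| + 1) by rewrite divr_gt0 ?ltr_wpDl.
have [r] := ell1_monomial_approx a e1; set b := \sum_(k <- r) _ => ar.
rewrite -[a](subrK b) DD [D b](_ : _ = 0) ?addr0; last first.
  by rewrite /b (big_morph D DD D0) big1.
apply: le_trans (DM _) _.
apply: le_trans (ler_wpM2r (ell1_norm_ge0 _) (ler_norm M)) _.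
apply: le_trans (ler_wpM2l M0 (ltW ar)) _.
by rewrite mulrCA ger_pMr// ler_pdivrMr ?ltr_wpDl// mul1r lerDl.
Qed.

End Ell1Approximation.

(** * The twisted convolution at the fixed points *)

Section TwistedConvolution.
Variables (R : realType) (X : topologicalType) (s : homeomorphism X).
Implicit Types (a b c : ell1 R X) (f g : C0 R X).

(** The map [p] is an iterate of [s] or of its inverse, so that it inherits the
    fixed points of [s]. *)
Lemma sigma_hat_powP (n : int) : exists p : X -> X,
  (forall f x, sigma_hat_pow s n f x = f (p x)) /\
  (forall x, s x = x -> p x = x).
Proof.
case: n => n.
  exists (iter n (homeo_inv s)); split=> [f x|x sx].
    by elim: n x => //= n IH x; rewrite IH -iterSr.
  by elim: n => //= n ->; rewrite -{1}sx homeo_funK.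
exists (iter n.+1 s); split=> [f x|x sx].
  rewrite /sigma_hat_pow.
  by elim: n.+1 x => //= m IH x; rewrite IH -iterSr.
by elim: n.+1 => //= m ->.
Qed.

Lemma sigma_hat_powD n : {morph @sigma_hat_pow R X s n : f g / f + g}.
Proof.
move=> f g; have [p [pE _]] := sigma_hat_powP n.
by apply: C0P => x; rewrite pE /= !pE.
Qed.

Lemma C0_mulDl f g h : C0_mul (f + g) h = C0_mul f h + C0_mul g h.
Proof. by apply: C0P => x /=; rewrite mulrDl. Qed.

Lemma C0_mulDr f g h : C0_mul f (g + h) = C0_mul f g + C0_mul f h.
Proof. by apply: C0P => x /=; rewrite mulrDr. Qed.

Definition conv_term a b (n k : int) : C0 R X :=
  C0_mul (a k) (sigma_hat_pow s k (b (n - k))).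

Lemma esum_conv_term a b n :
  (\esum_(k in [set: int]) (C0_norm (conv_term a b n k))%:E <=
   (ell1_norm b * ell1_norm a)%:E)%E.
Proof.
rewrite EFinM (ell1_normE a).
apply: le_trans (esum_normZl_le (ell1_norm_ge0 b) (fun k => C0_norm_ge0 (a k))).
apply: le_esum => k _; rewrite lee_fin (le_trans (C0_normM _ _))// mulrC.
rewrite ler_wpM2r ?C0_norm_ge0// (le_trans (C0_norm_sigma_hat_pow _ _ _))//.
exact: C0_norm_le_ell1_norm.
Qed.

Lemma conv_coef_cvg a b n :
  series (fun k : nat => conv_term a b n (Posz k) + conv_term a b n (Negz k))
    @ \oo --> conv s a b n.
Proof.
by apply: zseries_cvg; rewrite (le_lt_trans (esum_conv_term _ _ _))// ltry.
Qed.

Lemma normc_conv_le a b n x :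
  normc (conv s a b n x) <= ell1_norm b * ell1_norm a.
Proof.
rewrite (le_trans (normc_le_C0_norm _ _))// -lee_fin.
exact: le_trans (zseries_norm_le _) (esum_conv_term a b n).
Qed.

(** Stated for limits, since [zseries] is additive on convergent series only. *)
Lemma zseries_limD (u v w : int -> C0 R X) f g h :
  series (fun k : nat => u (Posz k) + u (Negz k)) @ \oo --> f ->
  series (fun k : nat => v (Posz k) + v (Negz k)) @ \oo --> g ->
  series (fun k : nat => w (Posz k) + w (Negz k)) @ \oo --> h ->
  (forall k, w k = u k + v k) -> h = f + g.
Proof.
move=> cu cv cw wE; apply: (@cvg_unique _ (@norm_hausdorff _ (C0 R X)) _ _ _ _ cw).
have -> : series (fun k : nat => w (Posz k) + w (Negz k)) =
    series (fun k : nat => u (Posz k) + u (Negz k)) \+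
    series (fun k : nat => v (Posz k) + v (Negz k)).
  apply/funext => n; rewrite /series /= -big_split /=.
  by apply: eq_bigr => k _; rewrite !wE addrACA.
exact: cvgD.
Qed.

Lemma convDl a b c : conv s (a + b) c = conv s a c + conv s b c.
Proof.
apply: ell1P => n; apply: zseries_limD.
- exact: conv_coef_cvg.
- exact: conv_coef_cvg.
- exact: conv_coef_cvg.
- by move=> k; rewrite /conv_term /= C0_mulDl.
Qed.

Lemma convDr a b c : conv s a (b + c) = conv s a b + conv s a c.
Proof.
apply: ell1P => n; apply: zseries_limD.
- exact: conv_coef_cvg.
- exact: conv_coef_cvg.
- exact: conv_coef_cvg.
- by move=> k; rewrite /conv_term /= sigma_hat_powD C0_mulDr.
Qed.

Lemma conv_coef_eq0 a b n x :
  (forall k, conv_term a b n k x = 0) -> conv s a b n x = 0.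
Proof.
move=> t0; apply: eq0_normc; apply/eqP; rewrite eq_le normc_ge0 andbT.
apply/ler_addgt0Pr => e e0; rewrite add0r.
have e0C : 0 < e%:C :> R[i] by rewrite ltcR.
have /cvgrPdist_lt/(_ _ e0C)[m _ /(_ m (leqnn m))] := @conv_coef_cvg a b n.
rewrite /= C0_normE ltcR => /ltW; apply: le_trans.
apply: le_trans (normc_le_C0_norm _ x); set S := series _ m.
have S0 : S x = 0.
  rewrite /S /series /=; elim/big_ind: _ => [//|f g fx gx|k _].
    by rewrite /= fx gx addr0.
  exact: etrans (congr2 +%R (t0 (Posz k)) (t0 (Negz k))) (addr0 0).
by rewrite /= S0 mulr0 addr0.
Qed.

(** The commutator at [x] is biadditive and bounded in each argument, so the
    claim reduces to monomials, first in [a] and then in [b]. For monomials the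
    coefficients are f * g and g * f at [x], because [x] is fixed. *)
Lemma commutator_fixed_point a b n x : s x = x ->
  (conv s a b - conv s b a) n x = 0.
Proof.
move=> sx.
have fixE f k : sigma_hat_pow s k f x = f x.
  by have [p [pE pf]] := sigma_hat_powP k; rewrite pE pf.
pose D (a b : ell1 R X) := (conv s a b - conv s b a) n x.
have DD c : {morph D c : a b / a + b}.
  by move=> a' b'; rewrite /D convDl convDr /= !mulN1r opprD addrACA.
have DC c d : D c d = - D d c by rewrite /D /= !mulN1r opprB.
have DM c d : normc (D c d) <= (ell1_norm c *+ 2) * ell1_norm d.
  rewrite /D (le_trans (ler_normcD _ _))// mulrnAl mulr2n lerD//.
    by rewrite mulrC normc_conv_le.
  rewrite (_ : normc _ = normc (conv s d c n x)) ?normc_conv_le//.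
  by rewrite /= mulN1r; apply: complexI; rewrite -!normcE normrN.
have Dmono f k g l : D (monomial f k) (monomial g l) = 0.
  rewrite /D !conv_monomial /= /monomial_coef (addrC k l).
  by case: ifP => _ /=; rewrite ?fixE ?(mulrC (g x)) mulN1r subrr.
apply: (ell1_functional_eq0 (DD a) (DM a)) => l.
rewrite DC; apply/eqP; rewrite oppr_eq0; apply/eqP.
by apply: (ell1_functional_eq0 (DD _) (DM _)) => k.
Qed.

Lemma Ker_Per1_ideal : two_sided_ideal s (Ker R (Per1 s)).
Proof.
split=> [n x _|a b ka kb n x sx|k a ka n x sx|a b kb n x sx|a b ka n x sx] //=.
- by rewrite ka// kb// addr0.
- by rewrite ka// mulr0.
- apply: conv_coef_eq0 => k /=; have [p [pE pf]] := sigma_hat_powP k.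
  by rewrite pE pf// kb// mulr0.
- by apply: conv_coef_eq0 => k /=; rewrite ka// mul0r.
Qed.

Lemma closed_Ker (S : set X) : closed (Ker R S).
Proof.
move=> a /closure_ell1P ka n x Sx.
apply: eq0_normc; apply/eqP; rewrite eq_le normc_ge0 andbT.
apply/ler_addgt0Pr => e /ka[b kb /ltW ab]; rewrite add0r; apply: le_trans ab.
apply: le_trans (C0_norm_le_ell1_norm _ n).
by apply: le_trans (normc_le_C0_norm _ x); rewrite /= kb// mulr0 addr0.
Qed.

Lemma commutator_ideal_sub_Ker :
  closed_commutator_ideal R s `<=` Ker R (Per1 s).
Proof.
move=> a; apply; split.
- exact: Ker_Per1_ideal.
- exact: closed_Ker.
- by move=> b c n x; exact: commutator_fixed_point.
Qed.

End TwistedConvolution.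

(** * Closed ideals of C0(X) *)

Section ClosedIdealsOfC0.
Variables (R : realType) (X : topologicalType).
Implicit Types (f g u v : C0 R X) (J : set (C0 R X)).

Lemma ge0_normc (z : R[i]) : 0 <= z -> z = (normc z)%:C.
Proof. by move=> z0; rewrite -normcE ger0_norm. Qed.

(** This division replaces cut-off functions: f / (1 + t) is dominated by f,
    hence in C0(X) even for unbounded t, while f - f / (1 + t) is f times
    t / (1 + t), which vanishes exactly with t and is close to f where t is
    large. *)
Lemma C0_damp f (t : X -> R[i]) : continuous t -> (forall x, 0 <= t x) ->
  exists g : C0 R X, forall x, g x = f x / (1 + t x).
Proof.
move=> ct t0.
have t1 x : 1 <= 1 + t x by rewrite lerDl.
have cg : continuous (fun x => f x / (1 + t x)).
  move=> x; apply: cvgM; first exact: C0_continuous.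
  apply: cvgV; first by rewrite gt_eqF// (lt_le_trans ltr01).
  by apply: cvgD; [exact: cvg_cst|exact: ct].
have vg : vanishes_at_infinity (fun x => f x / (1 + t x)).
  apply: (vanishes_dominated ler01 _ (@C0_vanishing _ _ f)) => x.
  rewrite mul1r -lecR -!normcE normf_div ler_pdivrMr ?normr_gt0; last first.
    by rewrite gt_eqF// (lt_le_trans ltr01).
  by rewrite ler_peMr// ger0_norm// (le_trans ler01).
by exists (MkC0 cg vg).
Qed.

Lemma C0_conj v : exists w : C0 R X, forall x, w x = (v x)^*.
Proof.
have nJ (z : R[i]) : normc z^* = normc z.
  by apply: complexI; rewrite -!normcE normcJ.
have cw : continuous (fun x => (v x)^* : R[i]).
  apply/continuous_normcP => t e e0.
  have /continuous_normcP/(_ t _ e0) := @C0_continuous _ _ v.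
  by apply: filterS => y; rewrite -[X in X < _]nJ rmorphB.
have vw : vanishes_at_infinity (fun x => (v x)^* : R[i]).
  apply: (vanishes_dominated ler01 _ (@C0_vanishing _ _ v)) => x.
  by rewrite mul1r nJ.
by exists (MkC0 cw vw).
Qed.

(** A finite subcover argument: nonnegativity makes a sum exceed [M] wherever
    one of its terms does. If no single [u] works, the sets of points of [K]
    left over by the admissible [u] generate a proper filter, and an admissible
    function exceeding [M] at a cluster point contradicts clustering. *)
Lemma compact_dominating J (M : R) (K : set X) : compact K ->
  J 0 -> (forall u v, J u -> J v -> J (u + v)) ->
  (forall x, K x ->
    exists u, [/\ J u, forall y, 0 <= u y & M < normc (u x)]) ->
  exists u, [/\ J u, forall y, 0 <= u y & forall x, K x -> M < normc (u x)].
Proof.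
move=> cK J0 JD Jx; apply: contrapT => noJ.
pose F (A : set X) := exists u, [/\ J u, forall y, 0 <= u y &
  forall x, K x -> M < normc (u x) \/ A x].
have FK : F K.
  by exists 0; split => // x; right.
have FF : ProperFilter F.
  split=> [[u [Ju u0 uK]]|]; first by apply: noJ; exists u; split => // x /uK[].
  split=> [|A B [u [Ju u0 uA]] [v [Jv v0 vB]]|A B AB [u [Ju u0 uA]]].
  - by exists 0; split => // x; right.
  - exists (u + v); split=> [|y|x Kx]; [exact: JD|exact: addr_ge0|].
    have le1 : normc (u x) <= normc ((u + v) x).
      by rewrite -lecR -!normcE !ger0_norm ?addr_ge0// lerDl.
    have le2 : normc (v x) <= normc ((u + v) x).
      by rewrite -lecR -!normcE !ger0_norm ?addr_ge0// lerDr.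
    have [ux|Ax] := uA x Kx; first by left; exact: lt_le_trans le1.
    have [vx|Bx] := vB x Kx; first by left; exact: lt_le_trans le2.
    by right.
  - by exists u; split => // x /uA[|/AB]; [left|right].
have [p [Kp clp]] := cK F FF FK.
have [u [Ju u0 up]] := Jx p Kp.
have Fu : F [set x | ~ M < normc (u x)].
  by exists u; split => // x _; case: (pselect (M < normc (u x))); [left|right].
have Nu : nbhs p [set x | M < normc (u x)].
  have up0 : 0 < normc (u p) - M by rewrite subr_gt0.
  have /cvgrPdist_lt/(_ _ up0) := @C0_normc_continuous _ _ u p.
  apply: filterS => x /= /(le_lt_trans (ler_norm _)).
  by rewrite ltrD2l ltrN2.
by have [x []] := clp _ _ Fu Nu.
Qed.

(** So a closed ideal contains every function that vanishes on its common
    zeros. On the compact set where |f| >= e some nonnegative [u] of the ideal exceeds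
    |f| / e; then f u / (1 + u) is in the ideal, and its distance f / (1 + u)
    to f is at most e, on that set because u is large and elsewhere because f
    is small. *)
Lemma C0_ideal_approx J f : J 0 ->
  (forall u v, J u -> J v -> J (u + v)) ->
  (forall (k : R[i]) u, J u -> J (k *: u)) ->
  (forall g u, J u -> J (C0_mul g u)) ->
  (forall x, f x != 0 -> exists2 u, J u & u x != 0) ->
  forall e : R, 0 < e -> exists2 g, J g & C0_norm (f - g) <= e.
Proof.
move=> J0 JD JZ JM Jf e e0.
have [L cL fL] := C0_vanishing f e0.
pose K := L `&` [set x | e <= normc (f x)].
have cK : compact K.
  apply: compact_closedI cL _.
  have /continuous_closedP := @C0_normc_continuous R X f.
  by move=> /(_ _ (@closed_ge _ e)).
pose M := C0_norm f / e.
have M0 : 0 <= M by rewrite divr_ge0 ?C0_norm_ge0 ?ltW.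
have [x [_ /= ex]|u [Ju u0 uK]] := compact_dominating (M := M) cK J0 JD.
  have [v Jv vx0] : exists2 v, J v & v x != 0.
    apply: Jf; apply: contraTneq ex => ->.
    by rewrite normc0 -ltNge.
  have [w wE] := C0_conj v.
  have wvE y : w y * v y = (normc (v y) ^+ 2)%:C.
    by rewrite wE mulrC -sqr_normc normcE rmorphXn.
  have nvx : 0 < normc (v x) ^+ 2.
    rewrite exprn_gt0// lt_neqAle normc_ge0 andbT eq_sym.
    by apply: contraNneq vx0 => /eq0_normc ->.
  have c0 : 0 <= (M + 1) / normc (v x) ^+ 2 by rewrite divr_ge0 ?ltW ?ltr_wpDl.
  (* A multiple of |v|^2, scaled to take the value M + 1 at x. *)
  exists (((M + 1) / normc (v x) ^+ 2)%:C *: C0_mul w v); split.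
  - by apply/JZ/JM.
  - by move=> y /=; rewrite wvE -rmorphM ler0c mulr_ge0// sqr_ge0.
  - rewrite /= wvE -rmorphM divfK ?gt_eqF// -ltcR -normcE ger0_norm ?ltcR ?ltrDl//.
    by rewrite ler0c ltW// ltr_wpDl.
have [g gE] := C0_damp f (@C0_continuous _ _ u) u0.
have u1 x : 1 + u x != 0 by rewrite gt_eqF// ltr_wpDr.
have n1 x : normc (1 + u x) = 1 + normc (u x).
  apply: complexI; rewrite -normcE ger0_norm ?addr_ge0//.
  by rewrite {1}(ge0_normc (u0 x)) rmorphD.
exists (C0_mul g u); first exact: JM.
apply: C0_norm_le => [|x]; first exact: ltW.
have -> : (f - C0_mul g u) x = f x / (1 + u x).
  by rewrite /= gE mulN1r; apply: (mulIf (u1 x)); rewrite mulrBl divfK//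
    mulrAC divfK// mulrDr mulr1 addrK.
rewrite normcM normcV n1 ler_pdivrMr ?ltr_wpDr ?normc_ge0//.
have fle : normc (f x) < e -> normc (f x) <= e * (1 + normc (u x)).
  by move=> /ltW/le_trans; apply; rewrite ler_peMr ?(ltW e0)// lerDl normc_ge0.
have [ef|/fle//] := leP e (normc (f x)).
have [Lx|/fL/fle//] := pselect (L x).
have /ltW Mu := uK x (conj Lx ef).
apply: le_trans (normc_le_C0_norm f x) _.
rewrite -ler_pdivrMl// mulrC (le_trans Mu)// lerDr.
exact: ler01.
Qed.

End ClosedIdealsOfC0.

(** * Ideals containing the commutators *)

Section KerSubIdeal.
Variables (R : realType) (X : topologicalType) (s : homeomorphism X).
Implicit Types (f g h k : C0 R X) (I : set (ell1 R X)).

Lemma monomialD n : {morph @monomial R X ^~ n : f g / f + g}.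
Proof.
move=> f g; apply: ell1P => m; rewrite /= /monomial_coef.
by case: ifP; rewrite ?addr0.
Qed.

Lemma monomialZ n (c : R[i]) f : monomial (c *: f) n = c *: monomial f n.
Proof.
apply: ell1P => m; rewrite /= /monomial_coef.
by case: ifP; rewrite ?scaler0.
Qed.

Lemma ell1_norm_monomial f n : ell1_norm (monomial f n) = C0_norm f.
Proof.
apply: EFin_inj; rewrite ell1_normE /= (esumID [set n]) => [|m _]; last first.
  by rewrite lee_fin C0_norm_ge0.
rewrite setTI esum_set1 ?lee_fin ?C0_norm_ge0// /monomial_coef eqxx.
rewrite esum1 ?adde0// => m [_ /= mn].
by case: eqP => // _; rewrite C0_norm0.
Qed.

Definition degree_part I (n : int) : set (C0 R X) := [set f | I (monomial f n)].

(** The commutator of f and g delta is g (f - f o s^-1) delta; the right factor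
    h delta^(n-1) moves it to degree [n]. *)
Lemma commutator_ideal_coef I n f g h :
  two_sided_ideal s I -> (forall a b, I (conv s a b - conv s b a)) ->
  degree_part I n (C0_mul (C0_mul g (f - sigma_hat s f)) (sigma_hat s h)).
Proof.
move=> [I0 ID IZ IL IR] IC; rewrite /degree_part /=.
have -> : n = 1 + (n - 1) by rewrite addrC subrK.
rewrite -(conv_monomial s _ h 1); apply: IR.
have := IC (monomial f 0) (monomial g 1).
rewrite !conv_monomial addr0 add0r -scaleN1r -monomialZ -monomialD.
congr (I (monomial _ _)); apply: C0P => x /=.
by rewrite !mulN1r mulrBr mulrC.
Qed.

(** Let f x != 0. With t separating x from y = s^-1 x, the function d = f / (1 + |t - t y|)
    agrees with f at y but not at x, so h = f - d has h x != 0 = h y and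
    f (h - h o s^-1) f, an element of the ideal of degree n, is nonzero at x. *)
Lemma Ker_sub_ideal I : two_sided_ideal s I -> closed I ->
  (forall a b, I (conv s a b - conv s b a)) ->
  (forall x y : X, x != y ->
    exists2 t : X -> R[i], continuous t & t x != t y) ->
  Ker R (Per1 s) `<=` I.
Proof.
move=> idI cI IC sep a ka; have [I0 ID IZ IL IR] := idI.
apply: closed_add_monomial_sub => // n.
set f := a n; have f0 x : s x = x -> f x = 0 by exact: ka.
apply: cI; apply/closure_ell1P => e e0.
have e2 : 0 < e / 2 by rewrite divr_gt0.
suff [g Jg fg] : exists2 g, degree_part I n g & C0_norm (f - g) <= e / 2.
  exists (monomial g n) => //; rewrite -[X in _ - X]scale1r -scaleNr.
  rewrite -monomialZ -monomialD ell1_norm_monomial scaleN1r (le_lt_trans fg)//.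
  by rewrite ltr_pdivrMr// ltr_pMr// ltr1n.
apply: C0_ideal_approx e2; rewrite /degree_part /=.
- have -> : monomial (0 : C0 R X) n = 0 :> ell1 R X.
    by rewrite -(scale0r 0) monomialZ scale0r.
  exact: I0.
- by move=> u v Iu Iv; rewrite monomialD; exact: ID.
- by move=> c u Iu; rewrite monomialZ; exact: IZ.
- move=> g u Iu; have := IL (monomial g 0) _ Iu.
  by rewrite conv_monomial add0r.
move=> x fx; pose y := homeo_inv s x.
have xy : x != y.
  apply: contra_neq fx => xy; apply: f0.
  by rewrite {1}xy homeo_invK.
have [t ct txy] := sep x y xy.
have [d dE] : exists d : C0 R X, forall z, d z = f z / (1 + `|t z - t y|).
  apply: C0_damp => [z|z]; last exact: normr_ge0.
  by apply: cvg_norm; apply: cvgB; [exact: ct|exact: cvg_cst].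
have [k kE] : exists k : C0 R X, sigma_hat s k = f.
  exists (sigma_hat (homeo_sym s) f).
  by apply: C0P => z /=; rewrite homeo_invK.
exists (C0_mul (C0_mul f ((f - d) - sigma_hat s (f - d))) (sigma_hat s k)).
  exact: commutator_ideal_coef.
have hy : (f - d) y = 0 by rewrite /= dE subrr normr0 addr0 divr1 mulN1r subrr.
have tpos : 0 < `|t x - t y| by rewrite normr_gt0 subr_eq0.
have t1 : 1 + `|t x - t y| != 0 by rewrite gt_eqF// ltr_wpDl.
have hx : (f - d) x != 0.
  rewrite /= dE mulN1r subr_eq0; apply: contra_neq fx => fxE.
  have : f x * `|t x - t y| = 0.
    apply: (addrI (f x)); rewrite addr0 -{1}[f x]mulr1 -mulrDr.
    by rewrite {1}fxE divfK.
  by move=> /eqP; rewrite mulf_eq0 (gt_eqF tpos) orbF => /eqP.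
rewrite kE [X in X != 0](_ : _ = f x * ((f - d) x - (f - d) y) * f x).
  by rewrite hy subr0 !mulf_neq0.
by rewrite /= !mulN1r.
Qed.

Theorem commutator_ideal_eq_Ker :
  (forall x y : X, x != y ->
    exists2 t : X -> R[i], continuous t & t x != t y) ->
  closed_commutator_ideal R s = Ker R (Per1 s).
Proof.
move=> sep; apply/seteqP; split; first exact: commutator_ideal_sub_Ker.
by move=> a ka I [idI cI IC]; exact: Ker_sub_ideal ka.
Qed.

End KerSubIdeal.

(** Evaluation at an element of A is continuous by definition of the Gelfand
    topology. *)
Lemma spectrum_separated (R : realType) (A : comCstarAlgType R)
    (x y : spectrum A) : x != y ->
  exists2 t : spectrum A -> R[i], continuous t & t x != t y.
Proof.
move=> xy.
have [a xya] : exists a, spectrum_eval x a != spectrum_eval y a.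
  apply: contrapT => nxy; move/eqP: xy; apply; apply: val_inj.
  apply/funext => a; apply: contrapT => xya; apply: nxy; exists a.
  exact/eqP.
exists (fun mu : spectrum A => spectrum_eval mu a) => // mu.
pose ev : spectrum A -> {ptws A -> R[i]} := set_val.
have GF := @fmap_filter _ _ ev _ (@nbhs_filter _ mu).
have : {ptws, ev @ nbhs mu --> set_val mu} by exact: initial_continuous.
by move=> /pointwise_cvgP/(_ a).
Qed.

Theorem theorem7p4 (R : realType) (A : comCstarAlgType R)
    (sigma : automorphism A) :
  closed_commutator_ideal R (sigma_tilde sigma) =
  Ker R (Per1 (sigma_tilde sigma)).
Proof. exact/commutator_ideal_eq_Ker/spectrum_separated. Qed.
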